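(* Let $g\in G_0(\Omega)$ be such that $\log g$ satisfies the weak Walters condition. Then there is a Borel probability measure $\nu$ on $\Omega$ such that for every $\varphi\in C(\Omega)$, $\mathscr{L}^n_{\log g}\varphi\to\int_\Omega\varphi\,d\nu$ uniformly on $\Omega$ as $n\to\infty$. Moreover, $\nu$ is the unique Borel probability measure satisfying $\mathscr{L}^*_{\log g}\nu=\nu$.
   Context: $(M,d)$ is a compact metric space and $\mu$ is a Borel probability measure on $M$ with $\operatorname{supp}\mu=M$. $\Omega=M^{\mathbb{N}}$ with metric $d_\Omega(x,y)=\sum_{n\ge1}2^{-n}d(x_n,y_n)$, $\sigma$ the left shift, $ax=(a,x_1,\dots)$ and $\mathbf{a}x=(a_1,\dots,a_n,x_1,\dots)$ for $\mathbf{a}\in M^n$. The Ruelle operator is $\mathscr{L}_f(\varphi)(x)=\int_M e^{f(ax)}\varphi(ax)\,d\mu(a)$, and $\mathscr{L}_f^*$ its dual acting on Borel measures. $G_0(\Omega)=\{g\in C(\Omega):g>0,\ \int_M g(ax)\,d\mu(a)=1\ \forall x\in\Omega\}$. $S_nf=\sum_{i=0}^{n-1}f\circ\sigma^i$; $C_f(x,y)=\sup_{n\ge1}\sup_{\mathbf{a}\in M^n}(S_nf(\mathbf{a}x)-S_nf(\mathbf{a}y))$; $f$ satisfies the weak Walters condition if $C_f(x,y)\to0$ as $d_\Omega(x,y)\to0$. *)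

(* Defs.v *)
From HB Require Import structures.
From mathcomp Require Import all_boot all_order all_algebra.
From mathcomp Require Import all_classical all_reals all_analysis.
Set Implicit Arguments. Unset Strict Implicit. Unset Printing Implicit Defensive.
Import Order.TTheory GRing.Theory Num.Theory.
Import numFieldNormedType.Exports.
Local Open Scope classical_set_scope.
Local Open Scope ring_scope.

(* Metric spaces carrying a distinguished point: measurable types in        *)
(* MathComp-Analysis are pointed, so the carrier M must be pointed in order *)
(* to carry a (Borel) measure.                                              *)
#[short(type="pmetricType")]
HB.structure Definition PMetric (K : numDomainType) :=
  { M of Metric K M & Pointed M }.

Section Shift.
Variables (R : realType) (M : pmetricType R).

(* Omega = M^N; a point x : Omega is the sequence (x 0, x 1, ...) which     *)
(* corresponds to (x_1, x_2, ...) in the paper.                             *)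
Definition Omega := nat -> M.

Definition dOmega (x y : Omega) : R :=
  limn (series (fun k : nat => (2%:R)^-1 ^+ k.+1 * mdist (x k) (y k))).

Definition shift (x : Omega) : Omega := fun n => x n.+1.

Definition pcons (a : M) (x : Omega) : Omega :=
  fun n => if n is k.+1 then x k else a.

Definition prepend (a : seq M) (x : Omega) : Omega :=
  fun k => if (k < size a)%N then nth (x 0%N) a k else x (k - size a)%N.

Definition dOmega_open (U : set Omega) : Prop :=
  forall x, U x -> exists2 r : R, 0 < r & [set y | dOmega x y < r] `<=` U.

Definition OmegaB := g_sigma_algebraType dOmega_open.

Definition MB := g_sigma_algebraType (@open M).

Definition dcontinuous (phi : Omega -> R) : Prop :=
  forall x (e : R), 0 < e -> exists2 d : R, 0 < d &
    forall y, dOmega x y < d -> `|phi x - phi y| < e.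

Definition msupport (mu : probability MB R) : set M :=
  [set x | forall U : set M, open U -> U x -> (0 < mu U)%E].

Definition ruelle (mu : probability MB R) (f phi : Omega -> R) (x : Omega) : R :=
  fine (\int[mu]_a ((expR (f (pcons a x)) * phi (pcons a x))%:E))%E.

Definition G0 (mu : probability MB R) (g : Omega -> R) : Prop :=
  [/\ dcontinuous g, (forall x, 0 < g x) &
      forall x, (\int[mu]_a (g (pcons a x))%:E = 1)%E].

Definition birkhoff (n : nat) (f : Omega -> R) (x : Omega) : R :=
  \sum_(i < n) f (iter i shift x).

Definition Cf (f : Omega -> R) (x y : Omega) : \bar R :=
  ereal_sup [set ((birkhoff (size a) f (prepend a x)
                   - birkhoff (size a) f (prepend a y))%:E)
            | a in [set a : seq M | (0 < size a)%N]].

Definition weak_walters (f : Omega -> R) : Prop :=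
  forall e : R, 0 < e -> exists2 d : R, 0 < d &
    forall x y, dOmega x y < d -> (`|Cf f x y| < e%:E)%E.

Definition dual_fixed (mu : probability MB R) (f : Omega -> R)
    (nu : probability OmegaB R) : Prop :=
  forall phi : Omega -> R, dcontinuous phi ->
    (\int[nu]_x (ruelle mu f phi x)%:E = \int[nu]_x (phi x)%:E)%E.

End Shift.

(* Main.v *)
(* Convergence. Comparing [exp (S_n f)] along [wx] and [wy] letter by letter,
   the weak Walters condition makes the family [L^n phi] equicontinuous (for
   [phi >= 1], which is enough since [L 1 = 1]). As [g] is bounded below and
   the support of [mu] is [M], [L^N] charges every cylinder of length [N] by a
   uniform amount [q > 0]; by equicontinuity [L^n phi] is almost constant on
   such a cylinder, so that [L^N] contracts the width of an interval containing
   the values of [L^n phi] by the factor [1 - q], up to an arbitrarily small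
   error. Hence [L^n phi] converges uniformly to a constant [Lambda phi].

   The measure. [Lambda] is a positive normalised linear functional which is
   continuous along decreasing sequences by Dini's theorem. It is represented
   through the outer measure of [A] given by the infimum of the bounds
   [sup_n Lambda (phi_n)], where [phi_n >= 0] is a nondecreasing sequence of
   continuous functions that eventually exceeds [1] at each point of [A]. Any
   fixed point [nu'] satisfies [int phi dnu' = int L^n phi dnu' -> Lambda phi],
   whence uniqueness. *)
Require Import Defs.
From HB Require Import structures.
From mathcomp Require Import all_boot all_order all_algebra.
From mathcomp Require Import all_classical all_reals all_analysis.
From mathcomp Require Import measurable_realfun.
From mathcomp Require Import ring lra.
Set Implicit Arguments. Unset Strict Implicit. Unset Printing Implicit Defensive.
Import Order.TTheory GRing.Theory Num.Theory.
Import numFieldNormedType.Exports.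
Local Open Scope classical_set_scope.
Local Open Scope ring_scope.

(** * Representation of Daniell functionals *)

Section daniell.
Context {R : realType} {T : pointedType}.
Variables (C : set (T -> R)) (L : (T -> R) -> R).

(** Covers are sequences rather than single functions, so that covers of countably many sets merge
    into one through partial sums. *)
Definition daniell_cover (A : set T) (c : R) := exists phi : nat -> T -> R,
  [/\ forall n, C (phi n), forall n x, 0 <= phi n x,
      forall x, nondecreasing_seq (phi ^~ x),
      forall x, A x -> exists n, 1 <= phi n x & forall n, L (phi n) <= c].

Definition daniell_outer (A : set T) : \bar R :=
  ereal_inf [set c%:E | c in daniell_cover A].

Hypothesis C_cst : forall c, C (cst c).
Hypothesis C_add : forall f g, C f -> C g -> C (fun x => f x + g x).
Hypothesis C_mul : forall f g, C f -> C g -> C (fun x => f x * g x).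
Hypothesis C_max : forall f g, C f -> C g -> C (fun x => Num.max (f x) (g x)).
Hypothesis C_bnd : forall f, C f -> exists B : R, forall x, `|f x| <= B.
Hypothesis L_add : forall f g, C f -> C g ->
  L (fun x => f x + g x) = L f + L g.
Hypothesis L_scale : forall (c : R) f, C f -> L (fun x => c * f x) = c * L f.
Hypothesis L_ge0 : forall f, C f -> (forall x, 0 <= f x) -> 0 <= L f.
Hypothesis L_one : L (cst 1) = 1.
Hypothesis L_cvg0 : forall phi : nat -> T -> R, (forall n, C (phi n)) ->
  (forall x, nonincreasing_seq (phi ^~ x)) ->
  (forall x, phi n x @[n --> \oo] --> 0) -> L (phi n) @[n --> \oo] --> 0.

Let C_scale c f : C f -> C (fun x => c * f x).
Proof. by move=> Cf; exact: (C_mul (C_cst c) Cf). Qed.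

Let C_opp f : C f -> C (fun x => - f x).
Proof.
move=> Cf; rewrite (_ : (fun x => _) = fun x => -1 * f x); first exact: C_scale.
by apply/funext => x; rewrite mulN1r.
Qed.

Let C_sub f g : C f -> C g -> C (fun x => f x - g x).
Proof. by move=> Cf Cg; apply: (C_add Cf); exact: C_opp. Qed.

Let C_min f g : C f -> C g -> C (fun x => Num.min (f x) (g x)).
Proof.
move=> Cf Cg.
rewrite (_ : (fun x => _) = fun x => - Num.max (- f x) (- g x)).
  by apply: C_opp; apply: C_max; exact: C_opp.
by apply/funext => x; rewrite oppr_max !opprK.
Qed.

Let C_sum (phi : nat -> T -> R) n : (forall i, C (phi i)) ->
  C (fun x => \sum_(i < n) phi i x).
Proof.
move=> Cphi; elim: n => [|n IHn].
  by under eq_fun do rewrite big_ord0; exact: C_cst.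
by under eq_fun do rewrite big_ord_recr; exact: C_add.
Qed.

Let L_opp f : C f -> L (fun x => - f x) = - L f.
Proof.
by move=> Cf; under eq_fun do rewrite -mulN1r; rewrite L_scale// mulN1r.
Qed.

Let L_sub f g : C f -> C g -> L (fun x => f x - g x) = L f - L g.
Proof. by move=> Cf Cg; rewrite L_add ?L_opp//; exact: C_opp. Qed.

Let L_cst c : L (cst c) = c.
Proof.
by rewrite -[RHS]mulr1 -L_one -L_scale//; congr L; apply/funext => x /=;
  rewrite mulr1.
Qed.

Let L_sum (phi : nat -> T -> R) n : (forall i, C (phi i)) ->
  L (fun x => \sum_(i < n) phi i x) = \sum_(i < n) L (phi i).
Proof.
move=> Cphi; elim: n => [|n IHn].
  by under eq_fun do rewrite big_ord0; rewrite big_ord0; exact: L_cst.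
under eq_fun do rewrite big_ord_recr; rewrite big_ord_recr/= -IHn.
by rewrite L_add//; exact: C_sum.
Qed.

Let L_le f g : C f -> C g -> (forall x, f x <= g x) -> L f <= L g.
Proof.
move=> Cf Cg fg; rewrite -subr_ge0 -L_sub//.
by apply: L_ge0 => [|x]; [exact: C_sub|rewrite subr_ge0].
Qed.

Let cover_ge0 A c : daniell_cover A c -> 0 <= c.
Proof.
by move=> [phi [Cphi phi0 _ _ /(_ 0%N)]]; apply: le_trans; exact: L_ge0.
Qed.

Let outer_ge0 A : (0 <= daniell_outer A)%E.
Proof.
by apply: le_ereal_inf_tmp => _ [c /cover_ge0 c0 <-]; rewrite lee_fin.
Qed.

Let outer_le A c : daniell_cover A c -> (daniell_outer A <= c%:E)%E.
Proof. by move=> Ac; apply: ereal_inf_lbound; exists c. Qed.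

Let coverT : daniell_cover setT 1.
Proof. by exists (fun=> cst 1); split => [||x m n _|x _|n] //; [exists 0%N|rewrite L_one]. Qed.

Let coverS A B c : A `<=` B -> daniell_cover B c -> daniell_cover A c.
Proof.
by move=> AB [phi [? ? ? Bphi ?]]; exists phi; split => // x /AB/Bphi.
Qed.

Let outer_fin_num A : daniell_outer A \is a fin_num.
Proof.
rewrite ge0_fin_numE// (@le_lt_trans _ _ 1%E) ?ltry//.
by apply: outer_le; exact: (coverS (@subsetT _ A)).
Qed.

Let outer0 : daniell_outer set0 = 0%E.
Proof.
apply/eqP; rewrite eq_le outer_ge0 andbT; apply: outer_le.
by exists (fun=> cst 0); split => [||x m n _|x|n] //; rewrite L_cst.
Qed.

Let le_outer : {homo daniell_outer : A B / A `<=` B >-> (A <= B)%E}.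
Proof.
move=> A B AB; apply: le_ereal_inf_tmp => _ [c Bc <-]; apply: outer_le.
exact: (coverS AB).
Qed.

Let outer_cover A (e : R) : 0 < e -> exists2 c, daniell_cover A c &
  c < fine (daniell_outer A) + e.
Proof.
move=> e0; have := lb_ereal_inf_adherent e0 (outer_fin_num A).
move=> [_ [c Ac <-]]; rewrite -[X in (X + _)%E]fineK ?outer_fin_num//.
by rewrite -EFinD lte_fin => ce; exists c.
Qed.

Let sum_geo_le (e : R) n : 0 < e -> \sum_(i < n) (e / 2 ^+ i.+1) <= e.
Proof.
move=> e0; suff -> : \sum_(i < n) (e / 2 ^+ i.+1) = e - e / 2 ^+ n.
  by rewrite gerBl divr_ge0// ?ltW// exprn_gt0.
elim: n => [|n IHn]; first by rewrite big_ord0 expr0 divr1 subrr.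
rewrite big_ord_recr/= {}IHn exprS; have : (2 : R) ^+ n != 0.
  by rewrite expf_neq0.
by move=> ?; field.
Qed.

(** Near-optimal covers [phi i] of the [A i], with excess [e / 2 ^+ i.+1], are merged diagonally:
    the [n]-th function is the sum of the [phi i n] over [i < n]. *)
Let outer_sigma_subadditive : sigma_subadditive daniell_outer.
Proof.
move=> A; have [->|Aoo] :=
  eqVneq (\sum_(i <oo) daniell_outer (A i))%E +oo%E; first by rewrite leey.
have Afin : (\sum_(i <oo) daniell_outer (A i))%E \is a fin_num.
  by rewrite ge0_fin_numE ?ltey// nneseries_ge0.
apply/lee_addgt0Pr => e e0.
have e20 i : 0 < e / 2 ^+ i.+1 by rewrite divr_gt0// exprn_gt0.
have /choice[phi phiP] i : exists phi : nat -> T -> R,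
    [/\ forall n, C (phi n), forall n x, 0 <= phi n x,
      forall x, nondecreasing_seq (phi ^~ x),
      forall x, A i x -> exists n, 1 <= phi n x &
      forall n, L (phi n) <= fine (daniell_outer (A i)) + e / 2 ^+ i.+1].
  have [c [phi [h1 h2 h3 h4 h5]] ce] := outer_cover (A i) (e20 i).
  by exists phi; split => // n; exact: le_trans (h5 n) (ltW ce).
have Cphi i n : C (phi i n) by case: (phiP i).
have phi0 i n x : 0 <= phi i n x by case: (phiP i).
have ndphi i x : nondecreasing_seq (phi i ^~ x) by case: (phiP i).
rewrite -[X in (X + _)%E]fineK// -EFinD; apply: outer_le.
exists (fun n x => \sum_(i < n) phi i n x); split.
- by move=> n; exact: (@C_sum (fun i => phi i n)).
- by move=> n x; exact: sumr_ge0.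
- move=> x; apply/nondecreasing_seqP => n; rewrite big_ord_recr/=.
  apply: (@le_trans _ _ (\sum_(i < n) phi i n.+1 x)); last by rewrite lerDl.
  by apply: ler_sum => i _; exact: ndphi.
- move=> x [i _ Aix]; have [_ _ _ /(_ _ Aix)[k phik] _] := phiP i.
  (* Past [i] the term of [A i] occurs in the sum; past [k] it is at least 1 at [x]. *)
  have ki : (i < maxn k i.+1)%N by rewrite leq_max ltnSn orbT.
  exists (maxn k i.+1); rewrite (bigD1 (Ordinal ki))//= ler_wpDr//.
    exact: sumr_ge0.
  by apply: (le_trans phik); apply: ndphi; exact: leq_maxl.
- move=> n; rewrite (@L_sum (fun i => phi i n))//.
  apply: (@le_trans _ _ (\sum_(i < n) (fine (daniell_outer (A i)) + e / 2 ^+ i.+1))).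
    by apply: ler_sum => i _; have [_ _ _ _] := phiP i; exact.
  rewrite big_split/= lerD ?sum_geo_le// -lee_fin fineK// -sumEFin.
  under eq_bigr do rewrite fineK//.
  by rewrite -(big_mkord xpredT (fun i => daniell_outer (A i)));
    exact: nneseries_lim_ge.
Qed.

(** * Caratheodory measurability of the sets where a function of [C] is positive *)

Let h (u : T -> R) (k : nat) x := Num.min 1 (k%:R * Num.max 0 (u x)).

Let h_ge0 u k x : 0 <= h u k x.
Proof. by rewrite /h le_min ler01/= mulr_ge0// le_max lexx. Qed.

Let h_le1 u k x : h u k x <= 1.
Proof. by rewrite /h ge_min lexx. Qed.

Let C_h u k : C u -> C (h u k).
Proof.
move=> Cu; apply: C_min; first exact: C_cst.
by apply: C_scale; apply: C_max => //; exact: C_cst.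
Qed.

Let nd_h u x : nondecreasing_seq (h u ^~ x).
Proof.
move=> m n mn; rewrite /h le_min ge_min lexx/= ge_min; apply/orP; right.
by apply: ler_wpM2r; [rewrite le_max lexx|rewrite ler_nat].
Qed.

(** At each point [h u k] reaches the indicator of [0 < u] after finitely many steps, so that
    multiplying a cover by it keeps the threshold 1 attained. *)
Let h_eq1 u x : 0 < u x -> exists k, h u k x = 1.
Proof.
move=> ux0; exists (Num.bound (u x)^-1).
apply/min_idPl; rewrite max_r ?ltW//.
rewrite -ltr_pdivrMr// mul1r.
by apply: archi_boundP; rewrite invr_ge0 ltW.
Qed.

Let h_eq0 u k x : ~ 0 < u x -> h u k x = 0.
Proof.
move=> /negP; rewrite -leNgt => ux; rewrite /h max_l// mulr0.
by apply/min_idPr.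
Qed.

(** A cover [phi] of [X] is split by [h u]: [phi n * h u n] covers the part inside [U], and
    [phi n * (1 - h u k)] with a fixed [k] covers the part outside, where [h u k] vanishes. If [k]
    nearly realises the supremum of [L (phi n * h u n)], the two costs add up to at most
    [c + e / 2]. *)
Let outer_caratheodory u : C u ->
  forall X, (daniell_outer (X `&` [set x | (0 < u x)%R]) +
    daniell_outer (X `&` ~` [set x | (0 < u x)%R]) <= daniell_outer X)%E.
Proof.
move=> Cu X; pose U := [set x | 0 < u x].
have h0 k x : 0 <= h u k x by exact: h_ge0.
have h1 k x : h u k x <= 1 by exact: h_le1.
have Ch k : C (h u k) by exact: C_h.
have ndh x : nondecreasing_seq (h u ^~ x) by exact: nd_h.
rewrite -(fineK (outer_fin_num X)) -(fineK (outer_fin_num (X `&` U))).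
rewrite -(fineK (outer_fin_num (X `&` ~` U))) -EFinD lee_fin.
apply/ler_addgt0Pr => e e0.
have e20 : 0 < e / 2 by rewrite divr_gt0.
have [c [phi [Cphi phi0 ndphi Xphi Lphi]] ce] := outer_cover X e20.
have Cphih n k : C (fun x => phi n x * h u k x) by exact: C_mul.
have le_phih m n k l : (m <= n)%N -> (k <= l)%N ->
    L (fun x => phi m x * h u k x) <= L (fun x => phi n x * h u l x).
  move=> mn kl; apply: L_le => // x; apply: ler_pM => //.
  - exact: ndphi.
  - exact: ndh.
pose S := [set L (fun x => phi n x * h u n x) | n in [set: nat]].
have supS : has_sup S.
  split; first by exists (L (fun x => phi 0%N x * h u 0%N x)), 0%N.
  exists c => _ [n _ <-]; apply: le_trans (Lphi n).
  by apply: L_le => // x; exact: ler_piMr.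
have U_le : fine (daniell_outer (X `&` U)) <= sup S.
  rewrite -lee_fin fineK//; apply: outer_le.
  exists (fun n x => phi n x * h u n x); split => //.
  - by move=> n x; exact: mulr_ge0.
  - by move=> x m n mn; apply: ler_pM => //; [exact: ndphi|exact: ndh].
  - move=> x [/Xphi[n phin] /h_eq1[k hk]]; exists (maxn n k).
    have -> : h u (maxn n k) x = 1.
      by apply/eqP; rewrite eq_le h1/= -[leLHS]hk ndh// leq_maxr.
    by rewrite mulr1 (le_trans phin)// ndphi// leq_maxl.
  - by move=> n; apply: sup_upper_bound => //; exists n.
have [_ [k _ <-] Lk] := sup_adherent e20 supS.
(* The index [k] is frozen because [1 - h u n] would decrease with [n], whereas a cover has to be
   nondecreasing. *)
have UC_le : fine (daniell_outer (X `&` ~` U)) <=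
    c - L (fun x => phi k x * h u k x).
  rewrite -lee_fin fineK//; apply: outer_le.
  have Ch1 : C (fun x => 1 - h u k x) by apply: C_sub => //; exact: C_cst.
  exists (fun n x => phi n x * (1 - h u k x)); split.
  - by move=> n; exact: C_mul.
  - by move=> n x; rewrite mulr_ge0// subr_ge0.
  - by move=> x m n mn; apply: ler_wpM2r; [rewrite subr_ge0|exact: ndphi].
  - by move=> x [/Xphi[n phin] /(h_eq0 k)->]; exists n; rewrite subr0 mulr1.
  (* Beyond [k], [L (phi _ * h u k)] is at least [L (phi k * h u k)], which can thus be subtracted
     from [c]. *)
  - move=> n; apply: (@le_trans _ _ (L (fun x => phi (maxn n k) x * (1 - h u k x)))).
      apply: L_le; [exact: C_mul|exact: C_mul|move=> x].
      by apply: ler_wpM2r; [rewrite subr_ge0|apply: ndphi; exact: leq_maxl].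
    under eq_fun do rewrite mulrBr mulr1.
    rewrite L_sub// lerB//; apply: le_phih => //; exact: leq_maxr.
lra.
Qed.

(** For a cover [phi] of the whole space, [psi n = max 0 (1 - phi n)] decreases to 0, hence so does
    [L (psi n)]; as [1 <= psi n + phi n], every cost [c] is at least 1 in the limit. *)
Let outerT : daniell_outer setT = 1%E.
Proof.
apply/eqP; rewrite eq_le outer_le//=.
apply: le_ereal_inf_tmp => _ [c [phi [Cphi phi0 ndphi Tphi Lphi]] <-].
rewrite lee_fin.
pose psi n x := Num.max 0 (1 - phi n x).
have Cpsi n : C (psi n).
  by apply: C_max; [exact: C_cst|apply: C_sub => //; exact: C_cst].
have : L (psi n) @[n --> \oo] --> 0.
  apply: L_cvg0 => // [x m n mn|x].
    rewrite /psi ge_max le_max lexx/= le_max lerD2l lerN2 ndphi//.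
    by rewrite orbT.
  apply: cvg_near_cst; have [m phim] := Tphi x I.
  exists m => // n /= mn; rewrite /psi max_l// subr_le0.
  by apply: (le_trans phim); exact: ndphi.
move=> psi0; rewrite -subr_le0 -(cvg_lim (@Rhausdorff R) psi0).
apply: limr_ge; first by apply/cvg_ex; exists 0.
near=> n; rewrite lerBlDr -L_one.
apply: (@le_trans _ _ (L (fun x => psi n x + phi n x))); last first.
  by rewrite L_add// lerD2l.
apply: L_le; [exact: C_cst|exact: C_add|move=> x /=].
by rewrite -lerBlDr /psi le_max lexx orbT.
Unshelve. all: by end_near. Qed.

(** * The representing measure, its integrals and its uniqueness *)

Variable G : set (set T).
Hypothesis GC : forall U, G U -> exists2 u, C u & U = [set x | 0 < u x].
Hypothesis CG : forall u, C u -> G [set x | 0 < u x].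

Let CG_gt (f : T -> R) (t : R) : C f -> G [set x | t < f x].
Proof.
move=> Cf; rewrite (_ : [set x | _] = [set x | 0 < f x - t]).
  by apply: CG; apply: C_sub => //; exact: C_cst.
by apply/seteqP; split => x /=; rewrite subr_gt0.
Qed.

Let measurable_C (f : g_sigma_algebraType G -> R) : C f -> measurable_fun setT f.
Proof.
move=> Cf; apply: (measurability _ (RGenOInfty.measurableE R)) => _ [_ [t ->] <-].
rewrite setTI; apply: sub_gen_smallest.
rewrite (_ : _ @^-1` _ = [set x | t < f x]); first exact: CG_gt.
by apply/seteqP; split => x /=; rewrite in_itv/= andbT.
Qed.

Lemma integrable_daniell (m : probability (g_sigma_algebraType G) R) f :
  C f -> m.-integrable setT (EFin \o f).
Proof.
move=> Cf; apply: measurable_bounded_integrable => //.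
- by rewrite (@le_lt_trans _ _ 1%E) ?ltry ?probability_le1.
- exact: measurable_C.
- have [B fB] := C_bnd Cf; exists B; split; first exact: num_real.
  by move=> y By x _; rewrite /= (le_trans (fB x))// ltW.
Qed.

Let Rintegral_C_sum (m : probability (g_sigma_algebraType G) R)
    (phi : nat -> T -> R) n : (forall i, C (phi i)) ->
  \int[m]_x (\sum_(i < n) phi i x) = \sum_(i < n) \int[m]_x phi i x.
Proof.
move=> Cphi; elim: n => [|n IHn].
  rewrite big_ord0; under eq_Rintegral do rewrite big_ord0.
  by rewrite Rintegral_cst// mul0r.
under eq_Rintegral do rewrite big_ord_recr.
by rewrite big_ord_recr/= -IHn RintegralD//; apply: integrable_daniell => //; exact: C_sum.
Qed.

Let clip (y : R) := Num.max 0 (Num.min 1 y).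

(** [clip (t - i%:R)] is the portion of the height [t] lying between [i] and [i + 1]. *)
Let sum_clip n (t : R) : 0 <= t ->
  \sum_(i < n) clip (t - i%:R) = Num.min t n%:R.
Proof.
move=> t0; elim: n => [|n IHn]; first by rewrite big_ord0; apply/esym/min_idPr.
rewrite big_ord_recr/= IHn /clip -natr1 /Num.max /Num.min.
by repeat case: ifPn; rewrite -?leNgt; lra.
Qed.

(* Slicing [n.+1 * f] into layers of height [1], each layer vanishes where the
   previous one is not saturated, and a layer covers its saturation set. *)
Let Rintegral_le (m : probability (g_sigma_algebraType G) R) :
  (forall A, measurable A -> m A = daniell_outer A) ->
  forall f, C f -> (forall x, 0 <= f x <= 1) -> \int[m]_x f x <= L f.
Proof.
move=> mE f Cf f01; apply/ler_addgt0Pr => e e0.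
pose n := Num.bound e^-1.
have ne : n.+1%:R^-1 < e.
  rewrite invf_plt ?posrE// (lt_trans (archi_boundP _)) ?invr_ge0 ?ltW//.
  by rewrite ltr_nat.
pose F (k : nat) x := clip (n.+1%:R * f x - k%:R).
have CF k : C (F k).
  apply: C_max; first exact: C_cst.
  apply: C_min; first exact: C_cst.
  by apply: C_sub; [exact: C_scale|exact: C_cst].
have F0 k x : 0 <= F k x by rewrite /F /clip le_max lexx.
have F1 k x : F k x <= 1 by rewrite /F /clip ge_max ler01 ge_min lexx.
have FE x : \sum_(i < n.+1) F i x = n.+1%:R * f x.
  have /andP[fx0 fx1] := f01 x.
  by rewrite sum_clip ?mulr_ge0//; apply/min_idPl; rewrite ler_piMr.
(* The bottom layer has no layer below to be compared with. Its bound 1 becomes an error of at most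
   [e] after division by [n.+1]. *)
have intF0 : \int[m]_x F 0%N x <= 1.
  apply: (@le_trans _ _ (\int[m]_x (cst 1 x))).
    by apply: le_Rintegral => //; exact: integrable_daniell.
  by rewrite Rintegral_cst//= (probability_setT m) mulr1.
have intFS k : \int[m]_x F k.+1 x <= L (F k).
  pose A : set (g_sigma_algebraType G) := [set x | 0 < F k.+1 x].
  have mA : measurable A by apply: sub_gen_smallest; exact: CG.
  apply: (@le_trans _ _ (fine (m A))); last first.
    rewrite -lee_fin fineK ?fin_num_measure// mE//; apply: outer_le.
    exists (fun=> F k); split => [||x a b _|x|a] //; rewrite /A/= /F /clip => Fx.
    exists 0%N; move: Fx; rewrite -natr1 /Num.max /Num.min.
    by repeat case: ifPn; rewrite -?leNgt; lra.
  have := @integral_indic _ _ _ m setT measurableT A mA.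
  rewrite setIT => <-; apply: le_Rintegral => //.
  - exact: integrable_daniell.
  - exact: integrable_indic.
  - move=> x _; rewrite indicE; have [xA|] := boolP (x \in A); first exact: F1.
    by move=> /negP; rewrite inE /A/= => /negP; rewrite -leNgt.
have : n.+1%:R * \int[m]_x f x <= 1 + n.+1%:R * L f.
  rewrite -L_scale// -RintegralZl//; last exact: integrable_daniell.
  have -> : \int[m]_x (n.+1%:R * f x) = \int[m]_x (\sum_(i < n.+1) F i x).
    by apply: eq_Rintegral => x _; rewrite FE.
  rewrite Rintegral_C_sum//.
  rewrite big_ord_recl lerD//.
  under [in leRHS]eq_fun do rewrite -FE.
  (* Layers 1 to [n] of the integral face layers 0 to [n - 1] of [L]; the top layer of [L] is
     dropped by positivity. *)
  rewrite L_sum// [leRHS]big_ord_recr/= ler_wpDr//; first exact: L_ge0.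
  by apply: ler_sum => i _; exact: intFS.
move=> H; rewrite -(@ler_pM2l _ n.+1%:R)// mulrDr (le_trans H)// addrC.
by rewrite lerD2l -ler_pdivrMl// mulr1 ltW.
Qed.

(** The outer measure is restricted to the sigma-algebra generated by [G]. For [0 <= f <= 1] the
    bound [Rintegral_le], applied to [f] and to [1 - f], gives both inequalities; a bounded [f] is
    reduced to this case by an affine change. *)
Theorem daniell_stone : exists nu : probability (g_sigma_algebraType G) R,
  forall f, C f -> \int[nu]_x f x = L f.
Proof.
have [nu nuE] : exists nu : probability (g_sigma_algebraType G) R,
    forall A, measurable A -> nu A = daniell_outer A.
  pose mu : {outer_measure set T -> \bar R} := HB.pack daniell_outer
    (isOuterMeasure.Build R T daniell_outer outer0 outer_ge0 le_outer
       outer_sigma_subadditive).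
  have Gcara : <<s G >> `<=` mu.-caratheodory.
    apply: smallest_sub; last first.
      move=> U /GC[u Cu ->]; apply: le_caratheodory_measurable.
      exact: outer_caratheodory.
    exact: (@sigma_algebra_measurable _ (caratheodory_type mu)).
  pose nu0 : set (g_sigma_algebraType G) -> \bar R := daniell_outer.
  have nu_sigma : semi_sigma_additive nu0.
    move=> A mA tA mbigA.
    apply: (@caratheodory_measure_sigma_additive _ _ mu) => //.
    - by move=> i; exact: (Gcara _ (mA i)).
    - exact: (Gcara _ mbigA).
  pose nu1 : {measure set (g_sigma_algebraType G) -> \bar R} := HB.pack nu0
    (isMeasure.Build _ _ _ nu0 outer0 outer_ge0 nu_sigma).
  pose nu : probability (g_sigma_algebraType G) R := HB.pack nu0
    (Measure.on nu1) (Measure_isProbability.Build _ _ _ nu1 outerT).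
  by exists nu.
exists nu.
have int_le := Rintegral_le nuE.
have int01 f : C f -> (forall x, 0 <= f x <= 1) -> \int[nu]_x f x = L f.
  move=> Cf f01; apply/eqP; rewrite eq_le int_le//=.
  have C1f : C (fun x => 1 - f x) by apply: C_sub => //; exact: C_cst.
  have f10 x : 0 <= 1 - f x <= 1 by have := f01 x; lra.
  have := int_le _ C1f f10; rewrite RintegralB//; first last.
  - exact: integrable_daniell.
  - exact: (integrable_daniell _ (C_cst 1)).
  rewrite Rintegral_cst//= (probability_setT nu) mulr1.
  by rewrite (L_sub (C_cst 1) Cf) L_one; lra.
move=> f Cf; have [B fB] := C_bnd Cf.
have B0 : 0 <= B by exact: le_trans (normr_ge0 _) (fB point).
(* The added 1 keeps [K] positive when [B] is 0. *)
pose K := 2 * B + 1; have K0 : 0 < K by rewrite /K ltr_wpDl// mulr_ge0.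
pose f1 x := K^-1 * (f x + B).
have Cf1 : C f1 by apply: C_scale; apply: C_add => //; exact: C_cst.
have fE : f = fun x => K * f1 x - B.
  by apply/funext => x; rewrite /f1 mulVKf ?gt_eqF// addrK.
have f101 x : 0 <= f1 x <= 1.
  have := fB x; rewrite ler_norml => /andP[fx1 fx2].
  rewrite /f1 mulrC ler_pdivlMr// ler_pdivrMr// /K; apply/andP; split; lra.
rewrite fE L_sub//; [|exact: C_scale|exact: C_cst].
rewrite L_scale// L_cst -(int01 _ Cf1 f101) -RintegralZl//; last first.
  exact: integrable_daniell.
rewrite RintegralB//; [|exact/integrable_daniell/C_scale|exact/integrable_daniell/C_cst].
by rewrite Rintegral_cst//= (probability_setT nu) mulr1.
Qed.

(** The sets [0 < u] form a pi-system, as minima stay in [C], and their measure is the monotone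
    limit of the integrals of [h u n], on which both measures agree. *)
Lemma daniell_unique (m1 m2 : probability (g_sigma_algebraType G) R) :
  (forall f, C f -> \int[m1]_x f x = \int[m2]_x f x) ->
  forall A : set (g_sigma_algebraType G), measurable A -> m1 A = m2 A.
Proof.
move=> m12; apply: (@g_sigma_algebra_measure_unique _ _ (g_sigma_algebraType G) G
  _ (fun=> setT)).
- by move=> U GU; exact: sub_gen_smallest.
- move=> _; rewrite (_ : setT = [set x | 0 < cst (1 : R) (x : T)]); first exact/CG/C_cst.
  by apply/seteqP; split => x //= _; exact: ltr01.
- by rewrite bigcup_const//; exists 0%N.
- move=> U V /GC[u Cu ->] /GC[v Cv ->].
  rewrite (_ : _ `&` _ = [set x | 0 < Num.min (u x) (v x)]).
    by apply: CG; exact: C_min.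
  by apply/seteqP; split => x /=; rewrite lt_min; [case=> -> ->|move/andP].
- move=> U GU; have [u Cu UE] := GC GU.
  have mU : measurable (U : set (g_sigma_algebraType G)) by exact: sub_gen_smallest.
  suff cvgU (m : probability (g_sigma_algebraType G) R) :
      (\int[m]_x (h u n x)%:E)%E @[n --> \oo] --> m U.
    apply: cvg_unique (cvgU m1) _ => //=.
    rewrite [X in X @ _ --> _](_ : _ = fun n => (\int[m2]_x (h u n x)%:E)%E); first exact: cvgU.
    apply/funext => n.
    have := congr1 (@EFin R) (m12 _ (C_h n Cu)); rewrite /Rintegral.
    by rewrite !fineK//; apply: integrable_fin_num => //; exact/integrable_daniell/C_h.
  rewrite -(setIT U) -(@integral_indic _ _ _ m setT measurableT U mU).
  rewrite (_ : (fun x => _) = (fun x => limn (fun n => (h u n x)%:E))); last first.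
    apply/funext => x; apply/esym/cvg_lim => //; apply: cvg_near_cst.
    rewrite indicE; have [|xU] := boolP (x \in U).
      rewrite inE UE => /h_eq1[k hk]; exists k => // n /= kn; congr EFin.
      by apply/eqP; rewrite eq_le h_le1 -[leLHS]hk nd_h.
    exists 0%N => // n _; rewrite h_eq0// => ux0; move/negP: xU; apply.
    by rewrite inE UE.
  apply: cvg_monotone_convergence => //.
  - by move=> n; apply/measurable_EFinP; apply: measurable_C; exact: C_h.
  - by move=> n x _; rewrite lee_fin.
  - by move=> x _ a b ab; rewrite lee_fin nd_h.
- by move=> _ /=; rewrite (probability_setT m1) ltry.
Qed.

End daniell.

(** * The metric space [Omega] *)

(** The near-covering form of compactness, with the filter [\oo] on the index. It turns local bounds
    into uniform ones; [n] typically encodes a bound [n%:R] or a threshold [n.+1%:R^-1]. *)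
Lemma compact_uniform (T : topologicalType) (P : nat -> T -> Prop) :
  compact [set: T] -> (forall m n x, (m <= n)%N -> P m x -> P n x) ->
  (forall x : T, exists n, \forall y \near x, P n y) ->
  exists n, forall x, P n x.
Proof.
move=> /compact_near_coveringP cT ndP nP.
have [x _|n _ nPT] := cT nat \oo P _.
  have [n Pn] := nP x; exists ([set y | P n y], [set i | (n <= i)%N]).
    by split => //; exists n.
  by move=> [y i] [/= Pny ni]; exact: ndP Pny.
by exists n => x; exact: (nPT n (leqnn n)).
Qed.

Section omega_metric.
Context {R : realType} {M : pmetricType R}.
Hypothesis cM : compact [set: M].
Implicit Types (x y z : Omega M) (phi psi : Omega M -> R).

Lemma mdist_bounded : exists2 D : R, 0 <= D & forall a b : M, mdist a b <= D.
Proof.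
have [m n a mn|a|n nP] := @compact_uniform M
    (fun n b => mdist (point : M) b <= n%:R) cM.
- by move=> /le_trans; apply; rewrite ler_nat.
- exists (Num.bound (mdist (point : M) a + 1)).
  apply/nbhs_ballP; exists 1 => //= b; rewrite ballEmdist/= => ab.
  apply: (le_trans (metric_triangle _ a _)).
  apply: (@le_trans _ _ (mdist (point : M) a + 1)); first by rewrite lerD2l ltW.
  by rewrite ltW// archi_boundP// addr_ge0// mdist_ge0.
- exists (n%:R + n%:R) => [|a b]; first by rewrite addr_ge0.
  apply: (le_trans (metric_triangle _ point _)).
  by rewrite lerD// metric_sym.
Qed.

Let dterm x y k : R := 2^-1 ^+ k.+1 * mdist (x k) (y k).

Let dterm_ge0 x y k : 0 <= dterm x y k.
Proof. by rewrite mulr_ge0 ?mdist_ge0// exprn_ge0. Qed.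

Let sum_half n : \sum_(k < n) (2^-1 : R) ^+ k.+1 <= 1.
Proof.
suff -> : \sum_(k < n) (2^-1 : R) ^+ k.+1 = 1 - 2^-1 ^+ n.
  by rewrite gerBl exprn_ge0.
elim: n => [|n IHn]; first by rewrite big_ord0 expr0 subrr.
by rewrite big_ord_recr/= IHn exprS; field.
Qed.

Let sum_dterm_le x y (D : R) n : 0 <= D -> (forall a b : M, mdist a b <= D) ->
  \sum_(k < n) dterm x y k <= D.
Proof.
move=> D0 leD; apply: (@le_trans _ _ (\sum_(k < n) 2^-1 ^+ k.+1 * D)).
  by apply: ler_sum => k _; apply: ler_wpM2l; rewrite ?leD// exprn_ge0.
by rewrite -big_distrl/= ler_piMl ?sum_half.
Qed.

Let nd_dterm x y : nondecreasing_seq (series (dterm x y)).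
Proof.
apply/nondecreasing_seqP => n; rewrite /series/= big_nat_recr//= lerDl.
exact: dterm_ge0.
Qed.

Let cvg_dterm x y : cvgn (series (dterm x y)).
Proof.
apply: nondecreasing_is_cvgn; first exact: nd_dterm.
have [D D0 leD] := mdist_bounded; exists D => _ [n _ <-].
by rewrite /series/= big_mkord sum_dterm_le.
Qed.

Let sum_dterm_le_dOmega x y n : \sum_(k < n) dterm x y k <= dOmega x y.
Proof.
by have := nondecreasing_cvgn_le (@nd_dterm x y) (@cvg_dterm x y) n;
  rewrite {1}/series/= big_mkord.
Qed.

Let dOmega_le x y (B : R) :
  (forall n, \sum_(k < n) dterm x y k <= B) -> dOmega x y <= B.
Proof.
move=> leB; apply: limr_le; first exact: cvg_dterm.
by apply: nearW => n; rewrite /series/= big_mkord.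
Qed.

Lemma dOmega_ge0 x y : 0 <= dOmega x y.
Proof. by have := sum_dterm_le_dOmega x y 0; rewrite big_ord0. Qed.

Lemma dOmegaxx x : dOmega x x = 0.
Proof.
apply/eqP; rewrite eq_le dOmega_ge0 andbT; apply: dOmega_le => n.
by rewrite big1// => k _; rewrite /dterm mdistxx mulr0.
Qed.

Lemma dOmegaC x y : dOmega x y = dOmega y x.
Proof. by congr (limn (series _)); apply/funext => k; rewrite metric_sym. Qed.

Lemma dOmega_triangle y x z : dOmega x z <= dOmega x y + dOmega y z.
Proof.
apply: dOmega_le => n.
apply: (@le_trans _ _ (\sum_(k < n) dterm x y k + \sum_(k < n) dterm y z k)).
  rewrite -big_split/=; apply: ler_sum => k _; rewrite /dterm -mulrDr.
  by apply: ler_wpM2l; [rewrite exprn_ge0|exact: metric_triangle].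
by rewrite lerD.
Qed.

(** Moving the series by one index halves its terms; in particular, prepending a common letter
    halves distances. *)
Lemma dOmega_pcons a b x y :
  dOmega (pcons a x) (pcons b y) <= (mdist a b + dOmega x y) / 2.
Proof.
apply: dOmega_le => -[|n].
  by rewrite big_ord0 divr_ge0// addr_ge0 ?mdist_ge0 ?dOmega_ge0.
rewrite big_ord_recl/= {1}/dterm/= expr1 mulrC mulrDl lerD2l.
apply: (@le_trans _ _ (\sum_(k < n) dterm x y k / 2)).
  by apply: ler_sum => k _; rewrite /dterm/= /bump/= exprS; lra.
by rewrite -mulr_suml ler_pM2r.
Qed.

Lemma pcons_shift x : pcons (x 0%N) (Defs.shift x) = x.
Proof. by apply/funext => -[]. Qed.

(** The first [N] letters contribute at most [r] and the tail at most [D * 2^-1 ^+ N]. The bound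
    propagates through [dOmega_pcons], since averaging [r] with [r + D * 2^-1 ^+ N] gives the next
    bound. *)
Lemma dOmega_cylinder (e : R) : 0 < e -> exists N : nat, exists2 r : R, 0 < r &
  forall x y, (forall i, (i < N)%N -> mdist (x i) (y i) < r) -> dOmega x y < e.
Proof.
move=> e0; have [D D0 leD] := mdist_bounded.
have cyl N (r : R) : 0 < r -> forall x y,
    (forall i, (i < N)%N -> mdist (x i) (y i) < r) ->
    dOmega x y <= r + D * 2^-1 ^+ N.
  move=> r0; elim: N => [|N IHN] x y xy.
    rewrite expr0 mulr1; apply: ler_wpDl; first exact: ltW.
    by apply: dOmega_le => n; exact: sum_dterm_le.
  rewrite -(pcons_shift x) -(pcons_shift y).
  apply: (le_trans (dOmega_pcons _ _ _ _)).
  have xy0 := xy 0%N isT.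
  have := IHN (Defs.shift x) (Defs.shift y) (fun i iN => xy i.+1 iN).
  rewrite exprS mulrCA; lra.
have : (D * 2^-1 ^+ n) @[n --> \oo] --> D * 0.
  apply: cvgM; [exact: cvg_cst|apply: cvg_expr].
  by rewrite ger0_norm// invf_lt1// ltr1n.
rewrite mulr0 => /cvgr_lt/(_ _ (divr_gt0 e0 (ltr0n R 2)))[N _ DN].
exists N, (e / 2) => [|x y xy]; first by rewrite divr_gt0.
apply: (le_lt_trans (cyl N _ _ x y xy)); first by rewrite divr_gt0.
by rewrite [ltRHS]splitr ltrD2l; exact: (DN N (leqnn N)).
Qed.

(** Tychonoff's theorem makes the product topology compact, and by [dOmega_cylinder] every [dOmega]
    ball contains a product neighbourhood of its centre. *)
Lemma Omega_uniform (P : nat -> Omega M -> Prop) :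
  (forall m n x, (m <= n)%N -> P m x -> P n x) ->
  (forall x, exists n, exists2 r : R, 0 < r &
     forall y, dOmega x y < r -> P n y) ->
  exists n, forall x, P n x.
Proof.
move=> ndP nP; apply: (@compact_uniform {ptws nat -> M} P _ ndP).
  have := @tychonoff nat (fun=> M) (fun=> setT) (fun=> cM).
  by congr compact; apply/seteqP.
move=> x; have [n [r r0 rP]] := nP x; exists n.
have [N [s s0 sP]] := dOmega_cylinder r0.
have : nbhs (x : {ptws nat -> M})
    [set y : {ptws nat -> M} | forall i : 'I_N, mdist (x i) (y i) < s].
  apply: (@filter_forall _ _ (fun (i : 'I_N) (y : {ptws nat -> M}) =>
    mdist (x i) (y i) < s) (nbhs x) (nbhs_filter x)) => i.
  have /(_ x) := @proj_continuous nat (fun=> M) i.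
  by move/(_ _ (nbhsx_ballx (x i) s s0)); rewrite ballEmdist.
apply: filterS => y xy; apply/rP/sP => i iN; exact: (xy (Ordinal iN)).
Qed.

(** * Continuous functions on the sequence space *)

Definition dOmega_filter x : set_system (Omega M) :=
  filter_from [set d : R | 0 < d] (fun d => [set y | dOmega x y < d]).

#[local] Instance dOmega_filter_filter x : Filter (dOmega_filter x).
Proof.
apply: filter_from_filter; first by exists 1 => /=.
move=> d e /= d0 e0; exists (Num.min d e); first by rewrite /= lt_min d0.
by move=> y /=; rewrite lt_min => /andP[].
Qed.

(** Written as convergence along a filter, continuity inherits its closure properties from the limit
    rules. *)
Lemma dcontinuousP phi :
  dcontinuous phi <-> forall x, phi @ dOmega_filter x --> phi x.
Proof.
split=> [cphi x|cphi x e e0].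
  apply/cvgrPdist_lt => e e0; have [d d0 dP] := cphi x e e0.
  by exists d.
by have /cvgrPdist_lt/(_ _ e0)[d d0 dP] := cphi x; exists d.
Qed.

Lemma dcontinuous_cst (c : R) : dcontinuous (cst c : Omega M -> R).
Proof. by apply/dcontinuousP => x; exact: cvg_cst. Qed.

Lemma dcontinuousD phi psi : dcontinuous phi -> dcontinuous psi ->
  dcontinuous (fun x => phi x + psi x).
Proof.
move=> /dcontinuousP cphi /dcontinuousP cpsi; apply/dcontinuousP => x.
exact: cvgD.
Qed.

Lemma dcontinuousM phi psi : dcontinuous phi -> dcontinuous psi ->
  dcontinuous (fun x => phi x * psi x).
Proof.
move=> /dcontinuousP cphi /dcontinuousP cpsi; apply/dcontinuousP => x.
exact: cvgM.
Qed.

Lemma dcontinuous_max phi psi : dcontinuous phi -> dcontinuous psi ->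
  dcontinuous (fun x => Num.max (phi x) (psi x)).
Proof.
move=> /dcontinuousP cphi /dcontinuousP cpsi; apply/dcontinuousP => x.
rewrite maxr_absE; under eq_fun do rewrite maxr_absE.
apply: cvgM; last exact: cvg_cst.
by apply: cvgD; [exact: cvgD|apply: cvg_norm; exact: cvgB].
Qed.

(** Continuity at [x] at scale [e / 2] gives one modulus for all points within [d / 2] of [x];
    compactness then makes it independent of [x]. *)
Lemma dcontinuous_uniform phi : dcontinuous phi -> forall e : R, 0 < e ->
  exists2 d : R, 0 < d & forall x y, dOmega x y < d -> `|phi x - phi y| < e.
Proof.
move=> cphi e e0.
have [m n x mn Pm y xy|x|n nP] := @Omega_uniform
    (fun n x => forall y, dOmega x y < n.+1%:R^-1 -> `|phi x - phi y| < e).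
- by apply: Pm; apply: (lt_le_trans xy); rewrite lef_pV2 ?posrE// ler_nat.
- have e20 : 0 < e / 2 by rewrite divr_gt0.
  have [d d0 dP] := cphi x _ e20; have d20 : 0 < d / 2 by rewrite divr_gt0.
  have [n _ nd] := near_infty_natSinv_lt (PosNum d20).
  exists n, (d / 2) => // y xy z yz.
  have xz : dOmega x z < d.
    apply: (le_lt_trans (dOmega_triangle y _ _)); rewrite [ltRHS]splitr ltrD//.
    exact: (lt_trans yz (nd n (leqnn n))).
  have xy' : dOmega x y < d by apply: (lt_trans xy); lra.
  have := dP _ xz; have := dP _ xy'.
  rewrite !ltr_norml => /andP[? ?] /andP[? ?]; apply/andP; split; lra.
- by exists n.+1%:R^-1.
Qed.

Lemma dcontinuous_bounded phi : dcontinuous phi ->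
  exists B : R, forall x, `|phi x| <= B.
Proof.
move=> cphi; have [m n x mn|x|n nP] := @Omega_uniform
    (fun n x => `|phi x| <= n%:R); last by exists n%:R.
- by move=> /le_trans; apply; rewrite ler_nat.
- have [d d0 dP] := cphi x 1 ltr01; exists (Num.bound (`|phi x| + 1)), d => // y.
  move=> /dP xy; rewrite ltW//.
  apply: lt_trans (archi_boundP _); last by rewrite addr_ge0.
  by rewrite -ltrBlDl (le_lt_trans _ xy)// distrC lerB_dist.
Qed.

Lemma dcontinuous_gt0 phi : dcontinuous phi -> (forall x, 0 < phi x) ->
  exists2 c : R, 0 < c & forall x, c <= phi x.
Proof.
move=> cphi phi0; have [m n x mn|x|n nP] := @Omega_uniform
    (fun n x => n.+1%:R^-1 <= phi x); last by exists n.+1%:R^-1.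
- by apply: le_trans; rewrite lef_pV2 ?posrE// ler_nat.
- have p20 : 0 < phi x / 2 by rewrite divr_gt0.
  have [d d0 dP] := cphi x _ p20.
  have [n _ nd] := near_infty_natSinv_lt (PosNum p20).
  exists n, d => // y /dP; rewrite ltr_norml => /andP[_ xy].
  apply: (le_trans (ltW (nd n (leqnn n)))) => /=; lra.
Qed.

(** The inequality [psi n x < e] persists in [n] by monotonicity and near [x] by continuity, as
    [Omega_uniform] requires. *)
Lemma dOmega_dini (psi : nat -> Omega M -> R) : (forall n, dcontinuous (psi n)) ->
  (forall x, nonincreasing_seq (psi ^~ x)) ->
  (forall x, psi n x @[n --> \oo] --> 0) ->
  forall e : R, 0 < e -> exists n, forall x, psi n x < e.
Proof.
move=> cpsi nipsi psi0 e e0; apply: Omega_uniform => [m n x mn|x].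
  by apply: le_lt_trans; exact: nipsi.
have e20 : 0 < e / 2 by rewrite divr_gt0.
have /cvgr_lt/(_ _ e20)[n _ nP] := psi0 x; have := nP n (leqnn n) => /= pn.
have [d d0 dP] := cpsi n x _ e20; exists n, d => // y /dP.
rewrite ltr_norml => /andP[? ?]; lra.
Qed.

Lemma dOmega_open_gt0 phi : dcontinuous phi -> dOmega_open [set x | 0 < phi x].
Proof.
move=> cphi x /= phix; have [d d0 dP] := cphi x _ phix; exists d => // y /dP.
by rewrite ltr_norml => /andP[_] /=; lra.
Qed.

(** The witness is the largest radius of a ball around [x] inside [U], capped at 1 so that it stays
    finite when [U] is everything. It is 1-Lipschitz by the triangle inequality. *)
Lemma dOmega_open_cozero (U : set (Omega M)) : dOmega_open U ->
  exists2 u, dcontinuous u & U = [set x | 0 < u x].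
Proof.
move=> oU; pose S x := [set r : R | 0 <= r <= 1 /\ [set y | dOmega x y < r] `<=` U].
have S0 x : S x 0.
  by split=> [|y /=]; [rewrite lexx ler01|rewrite ltNge dOmega_ge0].
have supS x : has_sup (S x).
  by split; [exists 0|exists 1 => r [/andP[_ r1] _]].
have lip x y : sup (S x) - dOmega x y <= sup (S y).
  rewrite lerBlDr; apply: ge_sup; first by exists 0.
  move=> r [/andP[r0 r1] rU]; rewrite -lerBlDr.
  have [rxy|xyr] := leP (r - dOmega x y) 0.
    by apply: (le_trans rxy); apply: sup_upper_bound.
  apply: sup_upper_bound => //; split.
    by rewrite ltW//= lerBlDr ler_wpDr// dOmega_ge0.
  move=> z /=; rewrite ltrBrDl => yz; apply: rU => /=.
  exact: le_lt_trans (dOmega_triangle y _ _) yz.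
exists (fun x => sup (S x)) => [x e e0|].
  exists e => // y xy; have := lip x y; have := lip y x.
  rewrite (dOmegaC y x) ltr_norml => ? ?; apply/andP; split; lra.
apply/seteqP; split => x /=.
  move=> /oU[r r0 rU]; apply: (@lt_le_trans _ _ (Num.min 1 r)).
    by rewrite lt_min ltr01.
  apply: sup_upper_bound => //; split.
    by rewrite le_min ler01 ltW//= ge_min lexx.
  by move=> y /=; rewrite lt_min => /andP[_]; exact: rU.
move=> supS0; have [r [_ rU]] := sup_adherent supS0 (supS x).
by rewrite subrr => r0; apply: rU => /=; rewrite dOmegaxx.
Qed.

End omega_metric.

(** * Iterates of the Ruelle operator *)

Section ruelle_operator.
Context {R : realType} {M : pmetricType R} {mu : probability (MB M) R}.
Context {g : Omega M -> R}.
Hypothesis cM : compact [set: M].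
Hypothesis hg : G0 mu g.
Implicit Types (x y z : Omega M) (phi psi : Omega M -> R).

Local Notation f := (fun x => ln (g x)).
Local Notation L := (ruelle mu f).

Let cg : dcontinuous g. Proof. by case: hg. Qed.

Let g_gt0 x : 0 < g x. Proof. by case: hg. Qed.

Lemma open_pcons_gt phi x (t : R) : dcontinuous phi ->
  open [set a : M | t < phi (pcons a x)].
Proof.
move=> cphi; rewrite openE => a /= ta; apply/nbhs_ballP.
have d0 : 0 < phi (pcons a x) - t by rewrite subr_gt0.
have [d dgt0 dP] := cphi (pcons a x) _ d0; exists d => // b.
rewrite ballEmdist/= => ab.
have : dOmega (pcons a x) (pcons b x) < d.
  apply: (le_lt_trans (dOmega_pcons cM _ _ _ _)); rewrite dOmegaxx// addr0.
  by rewrite ltr_pdivrMr// (lt_le_trans ab)// ler_peMr ?ltW// ltr1n.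
by move=> /dP; rewrite ltr_norml => /andP[_]; lra.
Qed.

Lemma integrable_pcons phi x : dcontinuous phi ->
  mu.-integrable setT (EFin \o (fun a => phi (pcons a x))).
Proof.
move=> cphi; apply: measurable_bounded_integrable => //.
- by rewrite (@le_lt_trans _ _ 1%E) ?ltry ?probability_le1.
- apply: (measurability _ (RGenOInfty.measurableE R)) => _ [_ [t ->] <-].
  rewrite setTI; apply: sub_gen_smallest.
  rewrite (_ : _ @^-1` _ = [set a | t < phi (pcons a x)]).
    exact: open_pcons_gt.
  by apply/seteqP; split => a /=; rewrite in_itv/= andbT.
- have [B phiB] := dcontinuous_bounded cM cphi.
  exists B; split; first exact: num_real.
  by move=> y By a _; rewrite /= (le_trans (phiB _))// ltW.
Qed.

Let integrable_gphi phi x : dcontinuous phi ->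
  mu.-integrable setT (EFin \o (fun a => g (pcons a x) * phi (pcons a x))).
Proof.
by move=> cphi; exact: (integrable_pcons x (dcontinuousM cg cphi)).
Qed.

Lemma ruelleE phi x : L phi x = \int[mu]_a (g (pcons a x) * phi (pcons a x)).
Proof.
by apply: eq_Rintegral => a _; rewrite lnK// posrE.
Qed.

Lemma ruelle_cst (c : R) x : L (cst c) x = c.
Proof.
rewrite ruelleE RintegralZr//; last exact: integrable_pcons.
by rewrite /Rintegral; case: hg => _ _ ->; rewrite mul1r.
Qed.

Lemma ruelleD phi psi x : dcontinuous phi -> dcontinuous psi ->
  L (fun x => phi x + psi x) x = L phi x + L psi x.
Proof.
move=> cphi cpsi; rewrite !ruelleE -RintegralD//; try exact: integrable_gphi.
by apply: eq_Rintegral => a _; rewrite mulrDr.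
Qed.

Lemma ruelleZ (c : R) phi x : dcontinuous phi ->
  L (fun x => c * phi x) x = c * L phi x.
Proof.
move=> cphi; rewrite !ruelleE -RintegralZl//; last exact: integrable_gphi.
by apply: eq_Rintegral => a _; rewrite mulrCA.
Qed.

Lemma le_ruelle phi psi x : dcontinuous phi -> dcontinuous psi ->
  (forall y, phi y <= psi y) -> L phi x <= L psi x.
Proof.
move=> cphi cpsi le_phi; rewrite !ruelleE.
apply: le_Rintegral => //; [exact: integrable_gphi|exact: integrable_gphi|].
by move=> a _; rewrite ler_pM2l.
Qed.

(** Prepending a common letter shrinks distances, so a uniform modulus of [g * phi] controls the
    integrands for all letters at once. *)
Lemma dcontinuous_ruelle phi : dcontinuous phi -> dcontinuous (L phi).
Proof.
move=> cphi x e e0; have cgphi := dcontinuousM cg cphi.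
have e20 : 0 < e / 2 by rewrite divr_gt0.
have [d d0 dP] := dcontinuous_uniform cM cgphi e20.
exists d => // y xy; rewrite !ruelleE -RintegralB//; try exact: integrable_gphi.
have intB : mu.-integrable setT (EFin \o (fun a => g (pcons a x) * phi (pcons a x)
    - g (pcons a y) * phi (pcons a y))).
  have := integrableB measurableT (integrable_gphi x cphi) (integrable_gphi y cphi).
  exact: eq_integrable.
apply: (le_lt_trans (le_normr_Rintegral _ intB)) => //.
apply: (@le_lt_trans _ _ (\int[mu]_a (cst (e / 2) a))).
  apply: le_Rintegral => //.
  - exact: (integrable_norm intB).
  - exact: (integrable_pcons x (@dcontinuous_cst _ M (e / 2))).
  - move=> a _; apply/ltW/dP.
    apply: (le_lt_trans (dOmega_pcons cM _ _ _ _)); rewrite mdistxx add0r.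
    have := dOmega_ge0 cM x y; lra.
rewrite Rintegral_cst//= (probability_setT mu) mulr1; lra.
Qed.

Lemma dcontinuous_iter_ruelle n phi : dcontinuous phi -> dcontinuous (iter n L phi).
Proof. by move=> cphi; elim: n => //= n; exact: dcontinuous_ruelle. Qed.

Lemma iter_ruelle_cst n (c : R) : iter n L (cst c) = cst c.
Proof.
elim: n => //= n ->; apply/funext => x; exact: ruelle_cst.
Qed.

Lemma iter_ruelleD n phi psi : dcontinuous phi -> dcontinuous psi ->
  iter n L (fun x => phi x + psi x) = fun x => iter n L phi x + iter n L psi x.
Proof.
move=> cphi cpsi; elim: n => //= n ->; apply/funext => x.
by rewrite ruelleD//; exact: dcontinuous_iter_ruelle.
Qed.

Lemma iter_ruelleZ n (c : R) phi : dcontinuous phi ->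
  iter n L (fun x => c * phi x) = fun x => c * iter n L phi x.
Proof.
move=> cphi; elim: n => //= n ->; apply/funext => x.
by rewrite ruelleZ//; exact: dcontinuous_iter_ruelle.
Qed.

Lemma iter_ruelle_affine n (c d : R) phi : dcontinuous phi ->
  iter n L (fun x => c * phi x + d) = fun x => c * iter n L phi x + d.
Proof.
move=> cphi.
have cc : dcontinuous (fun x => c * phi x).
  exact: (dcontinuousM (dcontinuous_cst c) cphi).
by rewrite (iter_ruelleD n cc (dcontinuous_cst d)) iter_ruelleZ// iter_ruelle_cst.
Qed.

Lemma le_iter_ruelle n phi psi : dcontinuous phi -> dcontinuous psi ->
  (forall y, phi y <= psi y) -> forall x, iter n L phi x <= iter n L psi x.
Proof.
move=> cphi cpsi le_phi; elim: n => //= n IHn x.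
by apply: le_ruelle => //; exact: dcontinuous_iter_ruelle.
Qed.

Lemma iter_ruelle_bounds n phi (lo hi : R) : dcontinuous phi ->
  (forall y, lo <= phi y <= hi) -> forall x, lo <= iter n L phi x <= hi.
Proof.
move=> cphi phi_bnd x; apply/andP; split.
  have := @le_iter_ruelle n _ _ (dcontinuous_cst lo) cphi _ x.
  by rewrite iter_ruelle_cst; apply => y; case/andP: (phi_bnd y).
have := @le_iter_ruelle n _ _ cphi (dcontinuous_cst hi) _ x.
by rewrite iter_ruelle_cst; apply => y; case/andP: (phi_bnd y).
Qed.

(** * Weights of words and equicontinuity of the iterates *)

Lemma prepend_cons (a : M) w x : prepend (a :: w) x = pcons a (prepend w x).
Proof.
by apply/funext => -[|n]; rewrite /prepend//= ltnS subSS.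
Qed.

Lemma prepend_nil x : prepend [::] x = x.
Proof. by apply/funext => n; rewrite /prepend/= subn0. Qed.

Lemma dOmega_prepend w x y : dOmega (prepend w x) (prepend w y) <= dOmega x y.
Proof.
elim: w => [|a w IHw]; first by rewrite !prepend_nil.
rewrite !prepend_cons; apply: (le_trans (dOmega_pcons cM _ _ _ _)).
rewrite mdistxx add0r; have := dOmega_ge0 cM x y; lra.
Qed.

(** The product of the values of [g] along the nonempty suffixes of [w] followed by [x], kept as an
    exponential to be compared through [Cf]. *)
Local Notation weight w x := (expR (birkhoff (size w) f (prepend w x))).

Let weight_cons a w x :
  weight (a :: w) x = g (pcons a (prepend w x)) * weight w x.
Proof.
rewrite prepend_cons /birkhoff/= big_ord_recl/= expRD; congr (_ * _).
  by rewrite lnK// posrE.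
by congr expR; apply: eq_bigr => i _; rewrite -iterS iterSr.
Qed.

(* The estimate is proved for all word lengths at once, since peeling one
   application of [L] off [L^n] lengthens the word [w] by one letter. *)
Lemma iter_ruelle_comparison n m phi x y (K : R) : dcontinuous phi ->
  (forall w, size w = (n + m)%N ->
     weight w x * phi (prepend w x) <= K * (weight w y * phi (prepend w y))) ->
  forall w, size w = m -> weight w x * iter n L phi (prepend w x) <=
    K * (weight w y * iter n L phi (prepend w y)).
Proof.
move=> cphi; elim: n m => [m H w wm|n IHn m H w wm] /=; first exact: H.
have cn := dcontinuous_iter_ruelle n cphi.
have wE z : weight w z * L (iter n L phi) (prepend w z) =
    \int[mu]_a (weight (a :: w) z * iter n L phi (prepend (a :: w) z)).
  rewrite ruelleE -RintegralZl//; last exact: integrable_gphi.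
  by apply: eq_Rintegral => a _; rewrite weight_cons prepend_cons mulrA (mulrC (weight w z)).
have intw (c : R) z : mu.-integrable setT (EFin \o (fun a =>
    c * (weight (a :: w) z * iter n L phi (prepend (a :: w) z)))).
  have cc : dcontinuous (fun u => c * (weight w z * (g u * iter n L phi u))).
    apply: (dcontinuousM (dcontinuous_cst c)).
    by apply: (dcontinuousM (dcontinuous_cst _)); exact: dcontinuousM.
  have := integrable_pcons (prepend w z) cc.
  apply: eq_integrable => // a _ /=.
  by rewrite weight_cons prepend_cons; congr EFin; ring.
rewrite !wE -RintegralZl//; last first.
  by have := intw 1 y; apply: eq_integrable => // a _ /=; rewrite mul1r.
apply: le_Rintegral => //.
  by have := intw 1 x; apply: eq_integrable => // a _ /=; rewrite mul1r.
move=> a _; apply: (IHn m.+1) => [v vm|]; last by rewrite /= wm.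
by apply: H; rewrite vm addnS.
Qed.

Hypothesis hW : weak_walters f.

(** Weak Walters at level [ln (1 + e)]; the distance [d] does not depend on the word [w]. *)
Let weight_le (e : R) : 0 < e -> exists2 d : R, 0 < d &
  forall w x y, dOmega x y < d -> weight w x <= (1 + e) * weight w y.
Proof.
move=> e0; have le0 : 0 < ln (1 + e) by rewrite ln_gt0// ltrDl.
have [d d0 dP] := hW le0; exists d => // w x y /dP Cxy.
have -> : 1 + e = expR (ln (1 + e)) by rewrite lnK// posrE ltr_wpDl.
rewrite -expRD ler_expR -lerBlDr.
(* [Cf] ranges over nonempty words only; the empty word has weight 1 on both sides. *)
case: w => [|a w].
  by rewrite /birkhoff !big_ord0 subrr ltW.
rewrite -lee_fin; apply: (le_trans _ (ltW Cxy)).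
apply: (le_trans _ (lee_abs _)).
by apply: ereal_sup_ubound; exists (a :: w).
Qed.

(** Passing from [u] to [v] costs a factor [1 + t] for the weight and another for the function,
    uniformly over words. Hence the iterates compare up to [(1 + t) * (1 + t)] for every [n], and
    their bound turns this into an additive error. *)
Lemma iter_ruelle_equicontinuous phi : dcontinuous phi ->
  forall e : R, 0 < e -> exists2 d : R, 0 < d &
  forall n x y, dOmega x y < d -> `|iter n L phi x - iter n L phi y| < e.
Proof.
move=> cphi e e0; have [B phiB] := dcontinuous_bounded cM cphi.
have B0 : 0 <= B := le_trans (normr_ge0 _) (phiB point).
(* Since [phi1 >= 1], an additive error [t] is at most a factor [1 + t]. *)
pose phi1 x := 1 * phi x + (B + 1).
have cphi1 : dcontinuous phi1.
  by apply: (dcontinuousD (dcontinuousM (dcontinuous_cst 1) cphi) (dcontinuous_cst _)).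
have phi1_bnd x : 1 <= phi1 x <= 2 * B + 1.
  have := phiB x; rewrite ler_norml /phi1 => /andP[? ?]; apply/andP; split; lra.
pose B1 := 2 * B + 1; have B10 : 0 < B1 by rewrite /B1 ltr_wpDl// mulr_ge0.
(* As [t <= 1], the final error [(2 * t + t * t) * B1] is at most [3 * t * B1], hence strictly below
   [e]. *)
pose t := Num.min 1 (e / (4 * B1)).
have t0 : 0 < t by rewrite lt_min ltr01 divr_gt0// mulr_gt0.
have t1 : t <= 1 by rewrite ge_min lexx.
have tB : t * (4 * B1) <= e by rewrite -ler_pdivlMr ?mulr_gt0// ge_min lexx orbT.
have [d1 d10 d1P] := weight_le t0.
have [d2 d20 d2P] := dcontinuous_uniform cM cphi1 t0.
exists (Num.min d1 d2) => [|n x y]; first by rewrite lt_min d10.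
have main u v : dOmega u v < Num.min d1 d2 ->
    iter n L phi u - iter n L phi v < e.
  rewrite lt_min => /andP[uv1 uv2].
  have : weight (@nil M) u * iter n L phi1 (prepend [::] u) <=
      (1 + t) * (1 + t) * (weight (@nil M) v * iter n L phi1 (prepend [::] v)).
    apply: (@iter_ruelle_comparison n 0 phi1 u v _ cphi1 _ [::]) => // w _.
    rewrite mulrACA; apply: ler_pM.
    - by rewrite expR_ge0.
    - by case/andP: (phi1_bnd (prepend w u)) => /(le_trans ler01).
    - exact: d1P.
    - have := d2P _ _ (le_lt_trans (dOmega_prepend w u v) uv2).
      have /andP[p1 _] := phi1_bnd (prepend w v).
      rewrite ltr_norml => /andP[_ ?]; nra.
  rewrite !prepend_nil /birkhoff/= !big_ord0 expR0 !mul1r.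
  have := iter_ruelle_bounds n cphi1 phi1_bnd v.
  rewrite !iter_ruelle_affine// -/B1 !mul1r.
  set U := iter n L phi u; set V := iter n L phi v => /andP[V1 V2] H.
  have : (U + (B + 1)) - (V + (B + 1)) <= (2 * t + t * t) * B1 by nra.
  have : t * t <= t by nra.
  nra.
move=> xy; rewrite ltr_norml main// andbT ltrNl opprB main//.
by rewrite dOmegaC.
Qed.

(** * Full support and contraction of the oscillation *)

Hypothesis hsupp : msupport mu = [set: M].

Let mball (a : M) (r : R) : set M := [set b | mdist a b < r].

Let open_mball a r : open (mball a r).
Proof.
rewrite openE => b /= ab; apply/nbhs_ballP; exists (r - mdist a b) => /=.
  by rewrite subr_gt0.
move=> c; rewrite ballEmdist/= ltrBrDl; exact: le_lt_trans (metric_triangle _ _ _).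
Qed.

Let measurable_mball a r : measurable (mball a r : set (MB M)).
Proof. by apply: sub_gen_smallest; exact: open_mball. Qed.

(** For [b] within [r / 2] of [a], the ball around [b] contains [mball a (r / 2)], which has
    positive mass by full support; compactness makes the bound uniform. *)
Let mball_measure (r : R) : 0 < r -> exists2 p : R, 0 < p &
  forall a : M, p <= fine (mu (mball a r)).
Proof.
move=> r0; have [m n b mn|a|n nP] := @compact_uniform M
  (fun n b => n.+1%:R^-1 <= fine (mu (mball b r))) cM; last by exists n.+1%:R^-1.
- by apply: le_trans; rewrite lef_pV2 ?posrE// ler_nat.
- have r20 : 0 < r / 2 by rewrite divr_gt0.
  have mu0 : (0 < mu (mball a (r / 2)))%E.
    have : msupport mu a by rewrite hsupp.
    by apply; [exact: open_mball|rewrite /mball/= mdistxx].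
  have fmu0 : 0 < fine (mu (mball a (r / 2))).
    by rewrite fine_gt0// mu0 ltey_eq fin_num_measure//; exact: measurable_mball.
  have [n _ nd] := near_infty_natSinv_lt (PosNum fmu0).
  exists n; apply/nbhs_ballP; exists (r / 2) => //= b; rewrite ballEmdist/= => ab.
  apply: (le_trans (ltW (nd n (leqnn n)))) => /=.
  rewrite fine_le ?fin_num_measure//; try exact: measurable_mball.
  apply: le_measure; rewrite ?inE; try exact: measurable_mball.
  move=> c; rewrite /mball/= => ac; apply: (le_lt_trans (metric_triangle _ a _)).
  by rewrite metric_sym [ltRHS]splitr ltrD.
Qed.

(** Each letter of the cylinder is integrated over a ball of mass at least [p] with density at least
    [c], which costs one factor [c * p]. *)
Let iter_ruelle_cylinder (c p r : R) : 0 < c -> 0 < p ->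
  (forall x, c <= g x) -> (forall a : M, p <= fine (mu (mball a r))) ->
  forall N y psi (b : R), dcontinuous psi -> (forall z, 0 <= psi z) ->
  (forall z, (forall i, (i < N)%N -> mdist (y i) (z i) < r) -> b <= psi z) ->
  forall x, b * (c * p) ^+ N <= iter N L psi x.
Proof.
move=> c0 p0 cg_le p_le N y psi b cpsi psi0 bpsi x.
(* Nonpositive [b] does occur in the application, where an error is subtracted; the claim then
   follows from positivity. *)
have [b0|b0] := leP b 0.
  apply: (@le_trans _ _ 0).
    by rewrite mulr_le0_ge0// exprn_ge0// mulr_ge0// ltW.
  have := @le_iter_ruelle N _ _ (dcontinuous_cst 0) cpsi psi0 x.
  by rewrite iter_ruelle_cst.
elim: N y psi b cpsi psi0 b0 bpsi x => [|N IHN] y psi b cpsi psi0 b0 bpsi x.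
  by rewrite expr0 mulr1; exact: bpsi.
(* The innermost [L] integrates the first letter, leaving a function bounded below on the cylinder
   of the shifted sequence. *)
rewrite iterSr exprS mulrA; apply: (IHN (Defs.shift y)).
- exact: dcontinuous_ruelle.
- move=> z; have := @le_ruelle _ _ z (dcontinuous_cst 0) cpsi psi0.
  by rewrite ruelle_cst.
- by rewrite !mulr_gt0.
move=> z yz; rewrite ruelleE.
apply: (@le_trans _ _ (\int[mu]_a (b * c * \1_(mball (y 0%N) r) a))).
  rewrite RintegralZl//; last first.
    by apply: integrable_indic => //; exact: measurable_mball.
  have mB := measurable_mball (y 0%N) r.
  rewrite /Rintegral (@integral_indic _ _ _ mu setT measurableT _ mB).
  by rewrite setIT mulrA ler_pM2l ?mulr_gt0//; exact: p_le.
apply: le_Rintegral => //.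
- apply: (@integrableZl _ _ _ mu setT measurableT (b * c)
    (EFin \o \1_(mball (y 0%N) r))).
  by apply: integrable_indic => //; exact: measurable_mball.
- exact: integrable_gphi.
- move=> a _; rewrite indicE; have [|_] := boolP (a \in mball (y 0%N) r).
    rewrite inE /mball/= => ya; rewrite mulr1 mulrC.
    apply: ler_pM => //; [exact: ltW|exact: ltW|].
    by apply: bpsi => -[|i]//= iN; exact: yz.
  by rewrite mulr0 mulr_ge0// ltW.
Qed.

Local Notation bounded_by n phi lo hi :=
  (forall x : Omega M, lo <= iter n L phi x <= hi).

Let bounded_byW m n phi lo hi : dcontinuous phi -> (m <= n)%N ->
  bounded_by m phi lo hi -> bounded_by n phi lo hi.
Proof.
move=> cphi mn H x; rewrite -(subnK mn) iterD.
by apply: iter_ruelle_bounds => //; exact: dcontinuous_iter_ruelle.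
Qed.

Lemma iter_ruelle_oscillation phi : dcontinuous phi ->
  forall e : R, 0 < e -> exists n lo hi, bounded_by n phi lo hi /\ hi - lo < e.
Proof.
move=> cphi e e0; have e40 : 0 < e / 4 by rewrite divr_gt0.
have [d d0 dP] := iter_ruelle_equicontinuous cphi e40.
have [N [r r0 rP]] := dOmega_cylinder cM d0.
have [c c0 c_le] := dcontinuous_gt0 cM cg g_gt0.
have [p p0 p_le] := mball_measure r0.
pose q := (c * p) ^+ N; have q0 : 0 < q by rewrite exprn_gt0// mulr_gt0.
have cyl := @iter_ruelle_cylinder c p r c0 p0 c_le p_le N.
(* Obtained by testing the cylinder bound on the constant 1. *)
have q1 : q <= 1.
  have := @cyl point (cst 1) 1 (dcontinuous_cst 1) (fun=> ler01) (fun _ _ => lexx 1) point.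
  by rewrite iter_ruelle_cst mul1r.
have step n lo hi : bounded_by n phi lo hi -> exists lo' hi',
    bounded_by (N + n) phi lo' hi' /\
    hi' - lo' <= (1 - q) * (hi - lo) + q * (e / 2).
  move=> H; have cn := dcontinuous_iter_ruelle n cphi.
  pose v := iter n L phi point.
  have near_v z : (forall i, (i < N)%N -> mdist ((point : Omega M) i) (z i) < r) ->
      `|v - iter n L phi z| < e / 4 by move=> /rP/dP; exact.
  (* The cylinder bound is applied to the iterate minus [lo] and to [hi] minus the iterate; on the
     cylinder around [point] they are at least [v - lo - e / 4] and [hi - v - e / 4]. *)
  exists (lo + (v - lo - e / 4) * q), (hi - (hi - v - e / 4) * q).
  split; last by lra.
  move=> x; rewrite iterD; apply/andP; split.
    have := @cyl point (fun x => 1 * iter n L phi x + - lo) (v - lo - e / 4) _ _ _ x.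
    rewrite iter_ruelle_affine// mul1r lerBrDl; apply.
    - by apply: (dcontinuousD (dcontinuousM (dcontinuous_cst 1) cn) (dcontinuous_cst _)).
    - by move=> z; rewrite mul1r subr_ge0; case/andP: (H z).
    - by move=> z /near_v; rewrite ltr_norml => /andP[? ?]; lra.
  have := @cyl point (fun x => -1 * iter n L phi x + hi) (hi - v - e / 4) _ _ _ x.
  rewrite iter_ruelle_affine// mulN1r => K.
  rewrite lerBrDr -lerBrDl [leRHS]addrC; apply: K.
  - by apply: (dcontinuousD (dcontinuousM (dcontinuous_cst (-1)) cn) (dcontinuous_cst _)).
  - by move=> z; rewrite mulN1r addrC subr_ge0; case/andP: (H z).
  - by move=> z /near_v; rewrite ltr_norml => /andP[? ?]; lra.
have [B phiB] := dcontinuous_bounded cM cphi.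
(* The affine recursion for the width has fixed point [e / 2], and the excess over it shrinks by
   [1 - q] at each step. *)
have iterate k : exists n lo hi, bounded_by n phi lo hi /\
    hi - lo <= (1 - q) ^+ k * (2 * B) + e / 2.
  elim: k => [|k [n [lo [hi [H W]]]]].
    exists 0%N, (- B), B; split; first by move=> x; rewrite -ler_norml.
    by rewrite expr0; lra.
  have [lo' [hi' [H' W']]] := step n lo hi H.
  exists (N + n)%N, lo', hi'; split => //; apply: (le_trans W').
  rewrite exprS; set Q := _ ^+ k * _ in W *.
  have : (1 - q) * (hi - lo) <= (1 - q) * (Q + e / 2).
    by apply: ler_wpM2l => //; rewrite subr_ge0.
  rewrite -mulrA -/Q; lra.
have : ((1 - q) ^+ k * (2 * B)) @[k --> \oo] --> 0 * (2 * B).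
  apply: cvgM; last exact: cvg_cst.
  by apply: cvg_expr; rewrite ger0_norm ?subr_ge0// gtrBl.
rewrite mul0r => /cvgr_lt/(_ _ (divr_gt0 e0 (ltr0n R 2)))[k _ kP].
have [n [lo [hi [H W]]]] := iterate k; exists n, lo, hi; split => //.
apply: (le_lt_trans W); rewrite [ltRHS]splitr ltrD2r.
exact: (kP k (leqnn k)).
Qed.

(** The limit is the supremum of all lower bounds of iterates. Bounds persist under further
    iteration, so any lower bound is below any upper bound and the supremum lies in every bounding
    interval. *)
Lemma iter_ruelle_cvg phi : dcontinuous phi -> exists l : R,
  forall e : R, 0 < e -> exists N : nat, forall n, (N <= n)%N ->
  forall x, `|iter n L phi x - l| < e.
Proof.
move=> cphi; pose S := [set lo | exists n hi, bounded_by n phi lo hi].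
have S_le n lo hi : bounded_by n phi lo hi -> ubound S hi.
  move=> H lo' [m [hi' H']].
  have /(_ point)/andP[_ le1] := bounded_byW cphi (leq_maxl n m) H.
  have /(_ point)/andP[le2 _] := bounded_byW cphi (leq_maxr n m) H'.
  exact: le_trans le2 le1.
exists (sup S) => e e0.
have [n [lo [hi [H W]]]] := iter_ruelle_oscillation cphi e0.
have Slo : S lo by exists n, hi.
have supS : has_sup S by split; [exists lo|exists hi; exact: S_le H].
have lo_le : lo <= sup S by exact: sup_upper_bound.
have hi_ge : sup S <= hi by apply: ge_sup; [exists lo|exact: S_le H].
exists n => m nm x; have /(_ x)/andP[? ?] := bounded_byW cphi nm H.
rewrite ltr_norml; apply/andP; split; lra.
Qed.

End ruelle_operator.

(** * The limit functional and its invariant measure *)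

Theorem mainTheorem7 (R : realType) (M : pmetricType R)
    (hM : compact [set: M]) (mu : probability (MB M) R)
    (hsupp : msupport mu = [set: M])
    (g : Omega M -> R) (hg : G0 mu g)
    (hW : weak_walters (fun x => ln (g x))) :
  exists nu : probability (OmegaB M) R,
    (forall phi : Omega M -> R, dcontinuous phi ->
       forall e : R, 0 < e -> exists N : nat, forall n : nat, (N <= n)%N ->
         forall x : Omega M,
           `|iter n (ruelle mu (fun x => ln (g x))) phi x
             - fine (\int[nu]_y (phi y)%:E)%E| < e) /\
    dual_fixed mu (fun x => ln (g x)) nu /\
    (forall nu' : probability (OmegaB M) R,
       dual_fixed mu (fun x => ln (g x)) nu' ->
       forall A : set (OmegaB M), measurable A -> nu' A = nu A).
Proof.
set L := ruelle mu (fun x => ln (g x)).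
pose C : set (Omega M -> R) := @dcontinuous R M.
have /choice[Lam LamP] : forall phi : Omega M -> R, exists l : R, C phi ->
    forall e : R, 0 < e -> exists N : nat, forall n, (N <= n)%N ->
    forall x, `|iter n L phi x - l| < e.
  (* Outside [C] the value 0 is an arbitrary default. *)
  move=> phi; have [Cphi|nCphi] := pselect (C phi); last by exists 0.
  by have [l lP] := iter_ruelle_cvg hM hg hW hsupp Cphi; exists l.
(* The limit is the same at all points; evaluating at [point] reduces the properties of [Lam] to
   limits of real sequences. *)
have Lam_cvg phi : C phi -> iter n L phi point @[n --> \oo] --> Lam phi.
  move=> Cphi; apply/cvgrPdist_lt => e e0; have [N NP] := LamP _ Cphi _ e0.
  by exists N => // n /= Nn; rewrite distrC; exact: NP.
have LamE phi l : C phi -> (iter n L phi point @[n --> \oo] --> l) -> Lam phi = l.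
  by move=> Cphi; apply: cvg_unique => //; exact: Lam_cvg.
have LamD phi psi : C phi -> C psi ->
    Lam (fun x => phi x + psi x) = Lam phi + Lam psi.
  move=> Cphi Cpsi; apply: LamE; first exact: dcontinuousD.
  under eq_fun do rewrite (iter_ruelleD hM hg)//.
  by apply: cvgD; exact: Lam_cvg.
have LamZ c phi : C phi -> Lam (fun x => c * phi x) = c * Lam phi.
  move=> Cphi; apply: LamE.
    exact: (dcontinuousM (dcontinuous_cst c) Cphi).
  under eq_fun do rewrite (iter_ruelleZ hM hg)//.
  by apply: cvgM; [exact: cvg_cst|exact: Lam_cvg].
have Lam_cst c : Lam (cst c) = c.
  apply: LamE; first exact: dcontinuous_cst.
  under eq_fun do rewrite (iter_ruelle_cst hM hg).
  exact: cvg_cst.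
have Lam_ge0 phi : C phi -> (forall x, 0 <= phi x) -> 0 <= Lam phi.
  move=> Cphi phi0; rewrite -(cvg_lim (@Rhausdorff R) (Lam_cvg _ Cphi)).
  apply: limr_ge; first by apply/cvg_ex; exists (Lam phi); exact: Lam_cvg.
  apply: nearW => n.
  have := le_iter_ruelle hM hg n (dcontinuous_cst 0) Cphi phi0 point.
  by rewrite (iter_ruelle_cst hM hg).
have Lam_cvg0 (psi : nat -> Omega M -> R) : (forall n, C (psi n)) ->
    (forall x, nonincreasing_seq (psi ^~ x)) ->
    (forall x, psi n x @[n --> \oo] --> 0) -> Lam (psi n) @[n --> \oo] --> 0.
  move=> Cpsi nipsi psi0.
  have psi_ge0 n x : 0 <= psi n x.
    rewrite -(cvg_lim (@Rhausdorff R) (psi0 x)).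
    apply: (nonincreasing_cvgn_ge (nipsi x)).
    by apply/cvg_ex; exists 0; exact: psi0.
  apply/cvgrPdist_lt => e e0; have e20 : 0 < e / 2 by rewrite divr_gt0.
  have [N NP] := dOmega_dini hM Cpsi nipsi psi0 e20.
  exists N => // n /= Nn; rewrite sub0r normrN ger0_norm; last exact: Lam_ge0.
  have : 0 <= Lam (fun x => e / 2 + -1 * psi n x).
    apply: Lam_ge0.
      by apply: (dcontinuousD (dcontinuous_cst _)
        (dcontinuousM (dcontinuous_cst (-1)) (Cpsi n))).
    move=> x; have := NP x; have := nipsi x _ _ Nn; lra.
  rewrite (LamD (cst (e / 2)))//; [|exact: dcontinuous_cst|].
    by rewrite Lam_cst LamZ//; lra.
  exact: (dcontinuousM (dcontinuous_cst (-1)) (Cpsi n)).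
have Ccst c : C (cst c) by exact: dcontinuous_cst.
have CD phi psi : C phi -> C psi -> C (fun x => phi x + psi x).
  exact: dcontinuousD.
have CM phi psi : C phi -> C psi -> C (fun x => phi x * psi x).
  exact: dcontinuousM.
have Cmax phi psi : C phi -> C psi -> C (fun x => Num.max (phi x) (psi x)).
  exact: dcontinuous_max.
have Cbnd phi : C phi -> exists B : R, forall x, `|phi x| <= B.
  exact: dcontinuous_bounded.
have CL phi : C phi -> C (L phi) by exact: dcontinuous_ruelle.
have CG phi : C phi -> dOmega_open [set x | 0 < phi x].
  exact: dOmega_open_gt0.
have GC U : dOmega_open U -> exists2 u, C u & U = [set x | 0 < u x].
  exact: dOmega_open_cozero.
have Cint (m : probability (OmegaB M) R) phi : C phi ->
    m.-integrable setT (EFin \o phi).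
  exact: integrable_daniell.
have [nu nuE] := daniell_stone Ccst CD CM Cmax Cbnd LamD LamZ Lam_ge0
  (Lam_cst 1) Lam_cvg0 GC CG.
exists nu; split; [|split].
- move=> phi Cphi e e0; have [N NP] := LamP _ Cphi _ e0.
  by exists N => n Nn x; have := NP n Nn x; rewrite -(nuE _ Cphi).
- move=> phi Cphi; rewrite -[LHS]fineK; last first.
    by apply: integrable_fin_num => //; exact/Cint/CL.
  rewrite -[RHS]fineK; last by apply: integrable_fin_num => //; exact/Cint.
  congr EFin; rewrite -/(Rintegral _ _ _) -[RHS]/(Rintegral _ _ _).
  have -> := nuE _ (CL _ Cphi); have -> := nuE _ Cphi.
  (* Invariance: the iterates of [L phi] are those of [phi] shifted by one, with the same limit. *)
  apply: LamE; first exact: CL.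
  have := Lam_cvg _ Cphi; rewrite -cvg_shiftS/=.
  by under eq_fun do rewrite -/(iter _.+1 L phi) iterSr.
- move=> nu' dnu'; apply: (daniell_unique Ccst CD CM Cmax Cbnd GC CG).
  move=> phi Cphi; rewrite (nuE _ Cphi).
  have iter_int n : \int[nu']_x iter n L phi x = \int[nu']_x phi x.
    elim: n => //= n <-; congr fine; apply: dnu'.
    exact: (dcontinuous_iter_ruelle hM hg).
  have int_cst c : \int[nu']_x (cst c x) = c.
    by rewrite Rintegral_cst//= (probability_setT nu') mulr1.
  (* The integral of [phi] equals that of its [N]-th iterate, which is uniformly within [e] of
     [Lam phi]. *)
  apply/eqP; rewrite eq_le; apply/andP; split; apply/ler_addgt0Pr => e e0;
    have [N NP] := LamP _ Cphi _ e0.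
  + rewrite -(iter_int N) -(int_cst (Lam phi + e)).
    apply: le_Rintegral => //; [|exact: Cint|].
      exact/Cint/(dcontinuous_iter_ruelle hM hg).
    by move=> x _ /=; have := NP N (leqnn N) x; rewrite ltr_norml => /andP[? ?]; lra.
  + rewrite -lerBlDr -(iter_int N) -(int_cst (Lam phi - e)).
    apply: le_Rintegral => //; [exact: Cint| |].
      exact/Cint/(dcontinuous_iter_ruelle hM hg).
    by move=> x _ /=; have := NP N (leqnn N) x; rewrite ltr_norml => /andP[? ?]; lra.
Qed.
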